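(* Let $a$ be an integer and let $n$ be a positive odd integer. Then, for an indeterminate $q$ (equivalently, for every complex number $q\neq 0,1$), $$\det\left[\left[\left\lceil\frac{(a+1)j-ak}{n}\right\rceil\right]_q\right]_{1\leqslant j,k\leqslant n}=\left(\frac{a(a+1)}{n}\right)q^{(n-1)/2}.$$
   Context: For an integer $m$, its $q$-analogue is $[m]_q=(1-q^m)/(1-q)$. $\lceil x\rceil$ denotes the least integer not smaller than $x$. $\left(\frac{\cdot}{n}\right)$ denotes the Jacobi symbol modulo the positive odd integer $n$ (equal to $0$ when the argument is not coprime to $n$, and $\left(\frac{\cdot}{1}\right)=1$). *)

(* Defs.v *)
From mathcomp Require Import all_boot all_order all_algebra.
Set Implicit Arguments. Unset Strict Implicit. Unset Printing Implicit Defensive.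
Import Order.TTheory GRing.Theory Num.Theory.
Local Open Scope ring_scope.

Definition qint (F : fieldType) (q : F) (m : int) : F := (1 - q ^ m) / (1 - q).

Definition legendre (x : int) (p : nat) : int :=
  if (p%:Z %| x)%Z then 0
  else if [exists y : 'I_p, (p%:Z %| (y%:Z) ^+ 2 - x)%Z] then 1 else -1.

Definition jacobi (x : int) (n : nat) : int :=
  \prod_(p <- primes n) legendre x p ^+ logn p n.

Definition ceil_frac (m : int) (n : nat) : int :=
  Num.ceil ((m%:~R : rat) / n%:R).

(* Main.v *)
Require Import Defs.
From mathcomp Require Import all_boot all_order all_algebra all_fingroup.
From mathcomp Require Import cyclic zify ring.
Set Implicit Arguments.
Unset Strict Implicit.
Unset Printing Implicit Defensive.
Import Order.TTheory GRing.Theory Num.Theory.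
Local Open Scope ring_scope.

(** If a prime [p] divides [n] and [a + 1], the rows [1], [1 + n/p] and [1 + 2n/p] have the form
    [1 - X], [1 - tX], [1 - t^2 X] up to a common factor, so the determinant vanishes; the case
    [p | a] is the same with columns.

    Otherwise, write [(a + 1) j = x + n u] and [a k = y + n v] with [0 <= x, y < n]. The ceiling is
    [u - v + (y < x)], so after permuting rows and columns and extracting diagonal factors one is
    left with the determinant of a rank one matrix minus the matrix with entries [q ^ (y < x)],
    which is computed explicitly and gives [q ^ ((n - 1) / 2)]. The permutations are, up to a
    common translation, the multiplications by the inverses of [a + 1] and [a] on the integers
    modulo [n]; by Zolotarev's lemma the product of their signs is the Jacobi symbol. *)

(** * Determinants of rank one perturbations *)

(** The block matrix [B] is factored by eliminating either diagonal block; the two Schur complements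
    have the same determinant. *)
Lemma det_add1_rank1 (R : comPzRingType) n (w : 'cV[R]_n) (r : 'rV[R]_n) :
  \det (1%:M + w *m r) = 1 + (r *m w) 0 0.
Proof.
pose B := block_mx 1%:M (- w) r 1%:M.
have B1 : B = block_mx 1%:M 0 r 1%:M *m block_mx 1%:M (- w) 0 (1%:M + r *m w).
  by rewrite mulmx_block !mul1mx ?mul0mx ?mulmx1 ?addr0 mulmxN addrCA addNr addr0.
have B2 : B = block_mx (1%:M + w *m r) (- w) 0 1%:M *m block_mx 1%:M 0 r 1%:M.
  by rewrite mulmx_block ?mul0mx ?mulmx0 ?mulmx1 ?mul1mx ?add0r mulNmx addrK.
transitivity (\det B).
  by rewrite B2 det_mulmx det_ublock det_lblock !det1 !mulr1.
rewrite B1 det_mulmx det_ublock det_lblock !det1 !mul1r.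
by rewrite det_mx11 !mxE.
Qed.

Definition step_mx (F : fieldType) (q : F) n : 'M[F]_n :=
  \matrix_(x < n, y < n) q ^+ (y < x)%N.

(** The entries are [q + (1 - q) * (x <= y)]. The last column of the unitriangular [U] is all ones,
    so the constant [q] is a rank one term that factors through [U]. *)
Lemma det_step_mx (F : fieldType) (q : F) n :
  q != 1 -> \det (step_mx q n.+1) = (1 - q) ^+ n.
Proof.
move=> q1; have q1' : 1 - q != 0 by rewrite subr_eq0 eq_sym.
pose U : 'M[F]_n.+1 := \matrix_(x, y) (x <= y)%N%:R.
have detU : \det U = 1.
  rewrite -det_tr det_trig; last by apply/is_trig_mxP => i j ij; rewrite !mxE leqNgt ij.
  by rewrite big1 // => i _; rewrite !mxE leqnn.
have -> : step_mx q n.+1 =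
    (1 - q) *: (U *m (1%:M + delta_mx ord_max (0 : 'I_1) *m const_mx (q / (1 - q)))).
  apply/matrixP=> x y; rewrite mulmxDr mulmx1 mulmxA -colE !mxE.
  rewrite big_ord1 !mxE leq_ord mul1r mulrDr mulrCA mulfV // mulr1.
  by case: ltnP; rewrite ?expr1 ?expr0 ?mulr0 ?mulr1 ?add0r ?subrK.
rewrite detZ det_mulmx detU mul1r det_add1_rank1 -colE !mxE exprSr -mulrA.
by rewrite mulrDr mulr1 mulrCA mulfV // mulr1 subrK mulr1.
Qed.

(* [A n.+1 = q * A 0] makes the differences of [A] solve [step_mx *m w = - A], so the matrix is
   [- step_mx] times a rank one perturbation of the identity. *)
Lemma det_rank1_sub_step_mx (F : fieldType) (q : F) n (A B : nat -> F) :
  q != 1 -> A n.+1 = q * A 0%N ->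
  \det (\matrix_(x < n.+1, y < n.+1) (A x * B y - q ^+ (y < x)%N)) =
  (-1) ^+ n.+1 * (1 - q) ^+ n *
  (1 + (\sum_(x < n.+1) B x * (A x.+1 - A x)) / (1 - q)).
Proof.
move=> q1 An; have q1' : 1 - q != 0 by rewrite subr_eq0 eq_sym.
pose w : 'cV[F]_n.+1 := \col_x ((A x.+1 - A x) / (1 - q)).
pose r : 'rV[F]_n.+1 := \row_y B y.
have Tw : step_mx q n.+1 *m w = - \col_x A x.
  apply/colP=> x; rewrite !mxE.
  pose f y := (A y.+1 - A y) / (1 - q).
  (* Splitting [q ^+ (y < x)] as [1 - (1 - q) * (y < x)] leaves two telescoping sums. *)
  transitivity (\sum_(y < n.+1) (f y - (1 - q) * (if (y < x)%N then f y else 0))).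
    apply: eq_bigr => y _; rewrite !mxE -/(f y).
    by case: ifP; rewrite ?expr1 ?expr0 ?mulr0 ?subr0 ?mul1r; first by move=> _; ring.
  rewrite big_split /= sumrN -mulr_sumr -big_mkcond /=.
  rewrite -(big_ord_widen _ f (ltnW (ltn_ord x))) -!(big_mkord xpredT f).
  rewrite -!mulr_suml !telescope_sumr // An.
  by field.
have -> : \matrix_(x < n.+1, y < n.+1) (A x * B y - q ^+ (y < x)%N) =
    - (step_mx q n.+1 *m (1%:M + w *m r)).
  rewrite mulmxDr mulmx1 mulmxA Tw; apply/matrixP=> x y.
  by rewrite !mxE big_ord1 !mxE; ring.
rewrite -scaleN1r detZ det_mulmx det_step_mx // det_add1_rank1 -mulrA; congr (_ * (_ * (1 + _))).
by rewrite !mxE mulr_suml; apply: eq_bigr => x _; rewrite !mxE mulrA.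
Qed.

(** * Parities of permutations *)

(** Through [e], [S] is a disjoint union of copies of [T] indexed by [U], and [s'] acts as [s] on
    each copy; its orbits are the copies of the orbits of [s]. *)
Lemma card_porbits_copies (U T S : finType) (e : U -> T -> S)
    (s : {perm T}) (s' : {perm S}) :
  (forall u u' x x', e u x = e u' x' -> u = u' /\ x = x') ->
  (forall z, exists u x, z = e u x) ->
  (forall u x, s' (e u x) = e u (s x)) ->
  #|porbits s'| = (#|U| * #|porbits s|)%N.
Proof.
move=> e_inj e_surj s'e.
have s'X k u x : (s' ^+ k)%g (e u x) = e u ((s ^+ k)%g x).
  by elim: k => [|k IH]; rewrite ?expg0 ?perm1 // !expgSr !permM IH s'e.
have orb u x : porbit s' (e u x) = e u @: porbit s x.
  apply/setP=> z; apply/porbitP/imsetP => [[k ->]|[y /porbitP[k ->] ->]].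
    by exists ((s ^+ k)%g x); rewrite ?mem_porbit.
  by exists k.
pose f (v : U * {set T}) := e v.1 @: v.2.
have -> : porbits s' = f @: setX setT (porbits s).
  apply/setP=> O; apply/imsetP/imsetP => [[z _ ->]|[[u P] /setXP[_ /imsetP[x _ ->]] ->]].
    have [u [x ->]] := e_surj z.
    by exists (u, porbit s x); rewrite ?orb // in_setX inE imset_f.
  by exists (e u x); rewrite ?orb.
rewrite card_in_imset ?cardsX ?cardsT // => -[u O] [u' O'].
move=> /setXP[_ /imsetP[x _ ->]] /setXP[_ /imsetP[x' _ ->]]; rewrite /f /= => E.
have : e u x \in e u' @: porbit s x' by rewrite -E imset_f ?porbit_id.
case/imsetP=> y yx' /e_inj[-> ->].
by congr (_, _); apply/eqP; rewrite eq_porbit_mem.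
Qed.

(** The parity is that of the cardinal plus the number of orbits, and both get multiplied by
    [#|U|]. *)
Lemma odd_perm_copies (U T S : finType) (e : U -> T -> S)
    (s : {perm T}) (s' : {perm S}) :
  (forall u u' x x', e u x = e u' x' -> u = u' /\ x = x') ->
  (forall z, exists u x, z = e u x) ->
  (forall u x, s' (e u x) = e u (s x)) ->
  odd_perm s' = odd #|U| && odd_perm s.
Proof.
move=> e_inj e_surj s'e.
have cardS : #|S| = (#|U| * #|T|)%N.
  rewrite -card_prod -(card_codom (f := fun v => e v.1 v.2)).
    apply: eq_card => z; apply/esym/codomP.
    by have [u [x ->]] := e_surj z; exists (u, x).
  by move=> [u x] [u' x'] /= /e_inj[-> ->].
rewrite /odd_perm (card_porbits_copies e_inj e_surj s'e) cardS !oddM.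
by case: (odd #|U|).
Qed.

Lemma odd_order_even_perm (T : finType) (s : {perm T}) m :
  odd m -> (s ^+ m)%g = 1%g -> odd_perm s = false.
Proof.
move=> om sm1; have sX k : odd_perm (s ^+ k)%g = odd k && odd_perm s.
  elim: k => [|k IH]; first by rewrite expg0 odd_perm1.
  by rewrite expgS odd_permM IH /=; case: (odd k); case: (odd_perm s).
by have := sX m; rewrite sm1 odd_perm1 om.
Qed.

(** * Residues and multiplication permutations *)

(** Ordinals, rather than ['Z_n], let permutations of residues act directly on matrix indices and
    include the modulus 1. *)
Definition imod n (z : int) : 'I_n.+1 := inord `|(z %% n.+1)%Z|.

Lemma imodE n (z : int) : (imod n z : nat)%:Z = (z %% n.+1)%Z.
Proof.
have ge0 : 0 <= (z %% n.+1)%Z by apply: modz_ge0.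
have lt_n : (z %% n.+1)%Z < n.+1 by apply: ltz_pmod.
by rewrite /imod inordK ?gez0_abs //; lia.
Qed.

Lemma eq_imod n (y z : int) : (imod n y == imod n z) = (n.+1 %| y - z)%Z.
Proof. by rewrite -eqz_mod_dvd -val_eqE /= -eqz_nat !imodE. Qed.

Lemma imodP n (y z : int) : reflect (exists k, y = z + k * n.+1%:Z) (imod n y == imod n z).
Proof.
rewrite eq_imod; apply: (iffP dvdzP) => -[k E]; exists k; first by rewrite -E addrC subrK.
by rewrite E addrC addKr.
Qed.

Lemma imod_val n (x : 'I_n.+1) : imod n (x : nat) = x.
Proof. by apply: val_inj => /=; apply/eqP; rewrite -eqz_nat imodE modz_nat modn_small. Qed.

Lemma imod0 n : imod n 0 = ord0.
Proof. exact: (imod_val ord0). Qed.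

Lemma imod_divz n (z : int) : (imod n z : nat)%:Z = z - (z %/ n.+1)%Z * n.+1.
Proof. by rewrite imodE {2}(divz_eq z n.+1) [X in _ = X]addrC addKr. Qed.

Lemma imodM n (b z : int) : imod n (b * imod n z) = imod n (b * z).
Proof.
by apply/eqP; rewrite imod_divz; apply/imodP; exists (- b * (z %/ n.+1)%Z); ring.
Qed.

Lemma imodD n (b z : int) : imod n (b + imod n z) = imod n (b + z).
Proof.
by apply/eqP; rewrite imod_divz; apply/imodP; exists (- (z %/ n.+1)%Z); ring.
Qed.

Lemma imod_mul_inj n (b : int) : coprimez b n.+1 -> injective (fun x : 'I_n.+1 => imod n (b * x)).
Proof.
move=> cop x y /eqP; rewrite eq_imod -mulrBr Gauss_dvdzr 1?coprimez_sym //.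
by rewrite -eq_imod !imod_val => /eqP.
Qed.

Lemma mul_perm_exists n (b : int) : coprimez b n.+1 ->
  exists s : {perm 'I_n.+1}, forall x, s x = imod n (b * x).
Proof. by move=> cop; exists (perm (imod_mul_inj cop)) => x; rewrite permE. Qed.

Lemma mul_permX n (b : int) (s : {perm 'I_n.+1}) k x :
  (forall x, s x = imod n (b * x)) -> (s ^+ k)%g x = imod n (b ^+ k * x).
Proof.
move=> sE; elim: k => [|k IH]; first by rewrite expg0 perm1 expr0 mul1r imod_val.
by rewrite expgSr permM IH sE imodM mulrA exprS.
Qed.

(** * Zolotarev's lemma for a prime modulus *)

Lemma primitive_root_exists p : prime p ->
  exists g : int, ~~ (p %| g)%Z /\
    forall b : int, ~~ (p %| b)%Z -> exists k, (p %| b - g ^+ k)%Z.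
Proof.
move=> pr.
have intr0 (z : int) : ((z%:~R : 'F_p) == 0) = (p %| z)%Z.
  rewrite dvdzE /= (dvdn_pcharf (pchar_Fp pr)).
  by case: (intP z) => [|k|k]; rewrite ?absz0 ?abszN ?mulr0z ?mulrNz ?oppr_eq0.
have /cyclicP[g gE] := field_unit_group_cyclic [set: {unit 'F_p}]%G.
have gN : (((val g : nat)%:Z)%:~R : 'F_p) = val g.
  by rewrite -pmulrn natr_Zp.
exists ((val g : nat)%:Z); rewrite -intr0 gN.
split=> [|b]; first by rewrite -unitfE (valP g).
rewrite -intr0 -unitfE => Ub.
have : FinRing.unit 'F_p Ub \in <[g]>%g by rewrite -gE inE.
case/cycleP=> k /(congr1 val) /= bE; exists k.
by rewrite -intr0 rmorphB rmorphXn /= gN bE FinRing.val_unitX subrr.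
Qed.

(** Multiplication by a primitive root has exactly two orbits, zero and the nonzero residues, on a
    set of odd size. *)
Lemma odd_perm_primitive_root n (g : int) (s : {perm 'I_n.+1}) :
  prime n.+1 -> odd n.+1 ->
  (forall b, ~~ (n.+1 %| b)%Z -> exists k, (n.+1 %| b - g ^+ k)%Z) ->
  (forall x, s x = imod n (g * x)) -> odd_perm s.
Proof.
move=> pr on gen sE.
have orb0 : porbit s (imod n 0) = [set imod n 0].
  apply/setP=> x; rewrite inE; apply/porbitP/eqP => [[k ->]|->].
    by rewrite (mul_permX _ _ sE) imodM mulr0.
  by exists 0%N; rewrite expg0 perm1.
have porbE : porbits s = [set porbit s (imod n 0); porbit s (imod n 1)].
  apply/setP=> O; rewrite !inE; apply/imsetP/orP => [[x _ ->]|].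
    have [|x0] := boolP (n.+1 %| (x : nat)%:Z)%Z.
      by rewrite -[X in X \in _]subr0 -eq_imod imod_val => /eqP ->; left.
    have [k] := gen _ x0; rewrite -eq_imod imod_val => /eqP ->; right.
    rewrite eq_porbit_mem -[X in imod _ X]mulr1 -imodM -(mul_permX _ _ sE).
    exact: mem_porbit.
  by case=> /eqP->; [exists (imod n 0) | exists (imod n 1)].
rewrite /odd_perm card_ord on porbE cards2 orb0.
suff -> : [set imod n 0] != porbit s (imod n 1) by [].
apply/eqP=> /setP/(_ (imod n 1)); rewrite porbit_id inE eq_imod subr0 dvdzE /= dvdn1.
by case/eqP=> n0; rewrite n0 in pr.
Qed.

(** With [b = g ^ k] for a primitive root [g], the sign is [(-1) ^ k], and [b] is a square exactly
    when [k] is even. *)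
Lemma zolotarev_prime n (b : int) (s : {perm 'I_n.+1}) :
  prime n.+1 -> odd n.+1 -> ~~ (n.+1 %| b)%Z ->
  (forall x, s x = imod n (b * x)) -> (-1) ^+ s = legendre b n.+1.
Proof.
move=> pr on b0 sE; rewrite /legendre (negbTE b0).
have [g [g0 gen]] := primitive_root_exists pr.
have gcop : coprimez g n.+1 by rewrite coprimez_sym coprimezE prime_coprime // -dvdzE.
have [t tE] := mul_perm_exists gcop.
have todd := odd_perm_primitive_root pr on gen tE.
have tX k : odd_perm (t ^+ k)%g = odd k.
  by elim: k => [|k IH]; rewrite ?odd_perm1 // expgS odd_permM IH todd.
have [k] := gen _ b0; rewrite -eq_imod => /eqP bk.
have s_tX c l : imod n c = imod n (g ^+ l) ->
      forall x : 'I_n.+1, imod n (c * x) = (t ^+ l)%g x.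
  by move=> E x; rewrite (mul_permX _ _ tE) (mulrC c) -(imodM n _ c) E imodM (mulrC _ (g ^+ l)).
have -> : s = (t ^+ k)%g by apply/permP=> x; rewrite sE (s_tX _ _ bk).
rewrite tX; case: ifP => [/existsP[y]|/negbT/existsPn noy].
  move=> yb; have y0 : ~~ (n.+1 %| (y : nat)%:Z)%Z.
    apply: contra b0 => ny; rewrite -[b](subKr ((y : nat)%:Z ^+ 2)) rpredB //.
    by rewrite expr2 dvdz_mulr.
  have [l] := gen _ y0; rewrite -eq_imod => /eqP yl.
  move: yb; rewrite -eq_imod => /eqP yb.
  (* Only parities of powers of [t] are compared, which avoids reducing exponents modulo the order
     of [g]. *)
  suff E : (t ^+ k = t ^+ (l + l))%g by rewrite -tX E tX addnn odd_double.
  apply/permP=> x; rewrite -(s_tX _ _ bk).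
  rewrite (mulrC b) -(imodM n _ b) -yb imodM expgD permM -(s_tX _ _ yl) -(s_tX _ _ yl) imodM.
  by congr imod; ring.
have [|ok] := boolP (odd k); first by rewrite expr1.
case/negP: (noy (imod n (g ^+ k./2))); rewrite -eq_imod bk expr2 imodM mulrC imodM.
by rewrite -exprD addnn halfK (negbTE ok) subn0.
Qed.

(** * Multiplicativity and Zolotarev's lemma for odd moduli *)

(** A bound [N] independent of [n] puts the symbols for [m] and [p * m] over the same index
    range. *)
Lemma jacobi_prodE x n N : (0 < n <= N)%N ->
  jacobi x n = \prod_(0 <= p < N.+1 | prime p) legendre x p ^+ logn p n.
Proof.
case/andP=> n0 nN; rewrite /jacobi [RHS](bigID (fun p => (p %| n)%N)) /=.
rewrite [X in _ = _ * X]big1 ?mulr1 => [|p /andP[_ /negbTE pn]]; last first.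
  by rewrite lognE pn !andbF.
rewrite -[RHS]big_filter; apply: perm_big; apply: uniq_perm; rewrite ?primes_uniq //.
  by rewrite filter_uniq ?iota_uniq.
move=> p; rewrite mem_primes mem_filter mem_index_iota n0 /=.
case: (prime p) => //=; case pn: (p %| n)%N => //=.
by rewrite ltnS (leq_trans (dvdn_leq n0 pn) nN).
Qed.

Lemma jacobi_prime_mul x p m : prime p -> (0 < m)%N ->
  jacobi x (p * m) = legendre x p * jacobi x m.
Proof.
move=> pr m0; have p0 := prime_gt0 pr.
have pm0 : (0 < p * m)%N by rewrite muln_gt0 p0.
rewrite !(@jacobi_prodE x _ (p * m)) ?m0 ?leq_pmull ?pm0 ?leqnn //.
under eq_bigr => l _ do rewrite lognM // exprD logn_prime //.
rewrite big_split /=; congr (_ * _).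
rewrite -big_filter (bigD1_seq p) ?filter_uniq ?iota_uniq // ; last first.
  by rewrite mem_filter pr mem_index_iota ltnS leq_pmulr.
by rewrite /= eqxx expr1 big1 ?mulr1 // => l /negbTE; rewrite eq_sym => ->.
Qed.

(* Writing [x = u + p.+1 * w], multiplication by [b] first multiplies [w], then translates [w] by
   a carry depending on [u] (a permutation of odd order), then multiplies [u]. *)
Lemma odd_mul_perm_product n p m (b : int)
    (s : {perm 'I_n.+1}) (sp : {perm 'I_p.+1}) (sm : {perm 'I_m.+1}) :
  n.+1 = (p.+1 * m.+1)%N -> odd n.+1 ->
  (forall x, s x = imod n (b * x)) -> (forall x, sp x = imod p (b * x)) ->
  (forall x, sm x = imod m (b * x)) -> odd_perm s = odd_perm sp (+) odd_perm sm.
Proof.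
move=> nE on sE spE smE.
have nZ : n.+1%:Z = p.+1%:Z * m.+1%:Z by rewrite nE PoszM.
have [op om] : odd p.+1 /\ odd m.+1 by apply/andP; rewrite -oddM -nE.
pose T : finType := ('I_p.+1 * 'I_m.+1)%type.
pose e (z : T) := imod n ((z.1 : nat)%:Z + p.+1%:Z * (z.2 : nat)%:Z).
have e_inj : injective e.
  move=> [u w] [u' w'] /eqP/imodP[k /=]; rewrite nZ => E.
  have uu : u = u'.
    rewrite -(imod_val u) -(imod_val u'); apply/eqP/imodP.
    exists ((w' : nat)%:Z - (w : nat)%:Z + k * m.+1%:Z).
    by apply: (addIr (p.+1%:Z * (w : nat)%:Z)); rewrite E; ring.
  congr (_, _) => //; rewrite -(imod_val w) -(imod_val w'); apply/eqP/imodP; exists k.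
  by apply: (@mulfI _ p.+1%:Z) => //; apply: (addrI (u : nat)%:Z); rewrite E uu; ring.
have e_surj z : exists x, z = e x.
  have [f _ fK] : bijective e.
    by apply: inj_card_bij => //; rewrite card_prod !card_ord nE.
  by exists (f z); rewrite fK.
have A_inj : injective (fun z : T => (z.1, sm z.2)).
  by move=> [u w] [u' w'] /= [-> /perm_inj ->].
have B_inj : injective (fun z : T => (sp z.1, z.2)).
  by move=> [u w] [u' w'] /= [/perm_inj -> ->].
pose c (u : 'I_p.+1) := ((b * (u : nat)%:Z) %/ p.+1%:Z)%Z.
have P_inj : injective (fun z : T => (z.1, imod m (c z.1 + (z.2 : nat)%:Z))).
  move=> [u w] [u' w'] /= [-> /eqP]; rewrite eq_imod opprD addrACA subrr add0r.
  by rewrite -eq_imod !imod_val => /eqP ->.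
pose A := perm A_inj; pose B := perm B_inj; pose P := perm P_inj.
have oddA : odd_perm A = odd_perm sm.
  rewrite (@odd_perm_copies 'I_p.+1 _ _ (fun u w => (u, w)) sm) ?card_ord ?op //.
  - by move=> u u' x x' [-> ->].
  - by move=> [u w]; exists u, w.
  - by move=> u x; rewrite permE.
have oddB : odd_perm B = odd_perm sp.
  rewrite (@odd_perm_copies 'I_m.+1 _ _ (fun w u => (u, w)) sp) ?card_ord ?om //.
  - by move=> u u' x x' [-> ->].
  - by move=> [u w]; exists w, u.
  - by move=> u x; rewrite permE.
have oddP : odd_perm P = false.
  (* Iterating the carry [m.+1] times adds a multiple of [m.+1], so [P] has odd order. *)
  apply: (odd_order_even_perm om); apply/permP=> -[u w]; rewrite perm1.
  have -> k : (P ^+ k)%g (u, w) = (u, imod m (k%:Z * c u + (w : nat)%:Z)).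
    elim: k => [|k IH]; first by rewrite expg0 perm1 mul0r add0r imod_val.
    rewrite expgSr permM IH permE /= imodD; congr (_, imod _ _).
    by rewrite intS; ring.
  congr (_, _); rewrite -[RHS]imod_val; apply/eqP/imodP; exists (c u); ring.
(* With a single copy, this is invariance of the parity under transport by the bijection [e]. *)
rewrite (@odd_perm_copies unit T _ (fun _ => e) (A * P * B)%g).
- by rewrite card_unit !odd_permM oddA oddP oddB addbF addbC.
- by move=> [] [] x x' /e_inj.
- by move=> z; have [x ->] := e_surj z; exists tt, x.
move=> _ [u w]; rewrite sE imodM !permM !permE /=.
rewrite spE smE imodD; apply/eqP/imodP; rewrite !imod_divz -/(c u) nZ.
exists ((c u + b * (w : nat)%:Z) %/ m.+1)%Z.
ring.
Qed.

(** Induction splitting off the smallest prime factor: the sign and the Jacobi symbol are both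
    multiplicative in the modulus. *)
Lemma zolotarev n (b : int) (s : {perm 'I_n.+1}) :
  odd n.+1 -> coprimez b n.+1 ->
  (forall x, s x = imod n (b * x)) -> (-1) ^+ s = jacobi b n.+1.
Proof.
elim/ltn_ind: n s => -[|n] IH s on cop sE.
  have -> : s = 1%g by apply/permP=> x; rewrite !ord1.
  by rewrite odd_perm1 /jacobi big_nil.
have pr : prime (pdiv n.+2) by apply: pdiv_prime.
have /dvdnP[m mE] := pdiv_dvd n.+2.
have {mE} : n.+2 = (pdiv n.+2 * m)%N by rewrite mulnC.
move: pr; case: (pdiv n.+2) => [|p] // pr.
case: m => [|m] nE; first by rewrite muln0 in nE.
have [op om] : odd p.+1 /\ odd m.+1 by apply/andP; rewrite -oddM -nE.
have [copp copm] : coprimez b p.+1 /\ coprimez b m.+1.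
  by apply/andP; rewrite -coprimezMr -PoszM -nE.
have [sp spE] := mul_perm_exists copp; have [sm smE] := mul_perm_exists copm.
rewrite (odd_mul_perm_product nE on sE spE smE) signr_addb nE jacobi_prime_mul //.
congr (_ * _); last by apply: IH => //; have := prime_gt1 pr; nia.
apply: zolotarev_prime => //.
by rewrite dvdzE -prime_coprime // -coprimezE coprimez_sym.
Qed.

(** * Ceilings and the vanishing case *)

Lemma jacobi_eq0 (x : int) p n :
  (0 < n)%N -> prime p -> (p %| n)%N -> (p %| x)%Z -> jacobi x n = 0.
Proof.
move=> n0 pr /dvdnP[m nE] px; rewrite nE mulnC jacobi_prime_mul //; last first.
  by move: n0; rewrite nE muln_gt0 => /andP[].
by rewrite /legendre px mul0r.
Qed.

Lemma ceil_frac_eq (m c : int) n :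
  (0 < n)%N -> (c - 1) * n%:Z < m <= c * n%:Z -> ceil_frac m n = c.
Proof.
move=> n0 /andP[lo hi]; apply: ceil_def.
have n0' : 0 < (n%:R : rat) by rewrite ltr0n.
rewrite ltr_pdivlMr // ler_pdivrMr // -[n%:R]/(n%:Z%:~R) -!intrM.
by rewrite ltr_int ler_int lo.
Qed.

Lemma ceil_fracD (m c : int) n :
  (0 < n)%N -> ceil_frac (m + c * n%:Z) n = ceil_frac m n + c.
Proof.
move=> n0; rewrite /ceil_frac intrD intrM mulrDl mulfK ?pnatr_eq0 -?lt0n //.
by rewrite ceilDrz ?intr_int // intrKceil.
Qed.

(** The coefficients [t], [-(1 + t)], [1] are those of the polynomial with roots 1 and [t], so they
    annihilate both [(1, 1, 1)] and [(1, t, t ^ 2)]. *)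
Lemma det_three_rows_eq0 (F : fieldType) n (A : 'M[F]_n) (i0 i1 i2 : 'I_n) (t d : F)
    (X : 'I_n -> F) :
  i0 != i2 -> i1 != i2 ->
  (forall k, A i0 k = (1 - X k) * d) -> (forall k, A i1 k = (1 - t * X k) * d) ->
  (forall k, A i2 k = (1 - t ^+ 2 * X k) * d) -> \det A = 0.
Proof.
move=> i02 i12 A0 A1 A2; apply/eqP/det0P.
exists (t *: delta_mx 0 i0 - (1 + t) *: delta_mx 0 i1 + delta_mx 0 i2).
  (* The combination is nonzero because its coordinate at [i2] is 1. *)
  apply/eqP=> /rowP/(_ i2); rewrite !mxE !eqxx /= ![i2 == _]eq_sym.
  rewrite (negbTE i02) (negbTE i12) !mulr0 subrr add0r; apply/eqP; exact: oner_neq0.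
rewrite !(mulmxDl, mulNmx) -!scalemxAl -!rowE; apply/rowP=> k.
by rewrite !mxE A0 A1 A2; ring.
Qed.

(** Moving down by [m = n / p] rows adds the integer [b' = b / p] to every ceiling. Since [p] is at
    least 3, two such moves from the first row stay inside the matrix. *)
Lemma det_qint_ceil_eq0 (F : fieldType) (q : F) n p (b : int) (f : 'I_n -> int) :
  (0 < n)%N -> q != 0 -> prime p -> odd p -> (p %| n)%N -> (p %| b)%Z ->
  \det (\matrix_(j < n, k < n) qint q (ceil_frac (b * (j.+1)%:Z + f k) n)) = 0.
Proof.
move=> n0 q0 pr op /dvdnP[m nE] /dvdzP[b' bE].
have p3 : (2 < p)%N by apply: odd_prime_gt2.
have m0 : (0 < m)%N by move: n0; rewrite nE muln_gt0 => /andP[].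
have lt0 : (0 * m < n)%N by [].
have lt1 : (1 * m < n)%N by nia.
have lt2 : (2 * m < n)%N by nia.
have E i (lti : (i * m < n)%N) k : ceil_frac (b * (Ordinal lti).+1%:Z + f k) n =
    ceil_frac (b + f k) n + b' *+ i.
  rewrite -ceil_fracD //; congr ceil_frac.
  by rewrite /= intS PoszM nE PoszM bE -mulr_natr natz; ring.
apply: (@det_three_rows_eq0 _ _ _ (Ordinal lt0) (Ordinal lt1) (Ordinal lt2) (q ^ b') (1 - q)^-1
          (fun k => q ^ ceil_frac (b + f k) n)).
- by rewrite -val_eqE /=; lia.
- by rewrite -val_eqE /=; lia.
- by move=> k; rewrite mxE /qint E mulr0n addr0.
- by move=> k; rewrite mxE /qint E mulr1n expfzDr // [_ * q ^ b']mulrC.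
- by move=> k; rewrite mxE /qint E mulr2n !expfzDr // expr2 [_ * (_ * _)]mulrC.
Qed.

Lemma det_perm_rows_cols (R : comPzRingType) n (A : 'M[R]_n) (s t : {perm 'I_n}) :
  \det A = (-1) ^+ (odd_perm s (+) odd_perm t) * \det (\matrix_(i, j) A (s i) (t j)).
Proof.
have -> : \matrix_(i, j) A (s i) (t j) = row_perm s (col_perm t A).
  by apply/matrixP=> i j; rewrite !mxE.
rewrite row_permE col_permE !det_mulmx !det_perm odd_permV signr_addb.
by case: (odd_perm s); case: (odd_perm t); rewrite ?expr0 ?expr1; ring.
Qed.

(** * The coprime case: carries and the permuted determinant *)

Section CoprimeCase.

Variables (F : fieldType) (q : F) (a : int) (n : nat) (A B : int).
Hypotheses (q0 : q != 0) (q1 : q != 1).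
Hypotheses (aA : imod n (A * a) = imod n 1) (aB : imod n (B * (a + 1)) = imod n 1).

Let N : int := n.+1%:Z.
(* The residue of [c * x] modulo [n.+1] taken in [1, n.+1], since rows and columns are indexed
   from 1. *)
Let rep (c : int) (x : nat) : nat := (imod n (c * x%:Z - 1)).+1.
(** These are the quotients [u] and [v] of the decomposition, expressed through the residue [x]
    instead of the row or column number; both divisions are exact. *)
Let row_carry x := (((a + 1) * (rep B x)%:Z - x%:Z) %/ N)%Z.
Let col_carry x := ((a * (rep A x)%:Z - x%:Z) %/ N)%Z.

Lemma mul_A_eq : exists k, A * a = 1 + k * N.
Proof. by apply/imodP/eqP. Qed.

Lemma mul_B_eq : exists k, B * (a + 1) = 1 + k * N.
Proof. by apply/imodP/eqP. Qed.

Lemma rep_divz c x : (rep c x)%:Z = c * x%:Z - ((c * x%:Z - 1) %/ N)%Z * N.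
Proof. by rewrite /rep intS imod_divz; ring. Qed.

Lemma row_carryE x : row_carry x * N = (a + 1) * (rep B x)%:Z - x%:Z.
Proof.
rewrite divzK // rep_divz; have [k E] := mul_B_eq; apply/dvdzP.
exists (k * x%:Z - (a + 1) * ((B * x%:Z - 1) %/ N)%Z).
have -> : (a + 1) * (B * x%:Z - ((B * x%:Z - 1) %/ N)%Z * N) =
  (B * (a + 1)) * x%:Z - (a + 1) * (((B * x%:Z - 1) %/ N)%Z * N) by ring.
by rewrite E; ring.
Qed.

Lemma col_carryE x : col_carry x * N = a * (rep A x)%:Z - x%:Z.
Proof.
rewrite divzK // rep_divz; have [k E] := mul_A_eq; apply/dvdzP.
exists (k * x%:Z - a * ((A * x%:Z - 1) %/ N)%Z).
have -> : a * (A * x%:Z - ((A * x%:Z - 1) %/ N)%Z * N) =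
  (A * a) * x%:Z - a * (((A * x%:Z - 1) %/ N)%Z * N) by ring.
by rewrite E; ring.
Qed.

Lemma rep0 c : rep c 0 = n.+1.
Proof.
rewrite /rep mulr0 sub0r; congr S.
suff -> : imod n (-1) = ord_max by [].
rewrite -(imod_val ord_max); apply/eqP/imodP; exists (-1) => /=.
by rewrite intS; ring.
Qed.

Lemma repN c : rep c n.+1 = n.+1.
Proof.
rewrite -[RHS](rep0 c); congr S; congr nat_of_ord; apply/eqP/imodP; exists c; ring.
Qed.

Lemma rep_neq0 c (x : 'I_n.+1) : imod n (c * (x : nat)%:Z) != imod n 0 ->
  rep c x = imod n (c * (x : nat)%:Z).
Proof.
set z := imod n (c * _) => z0; have zpos : (0 < z)%N.
  rewrite lt0n; apply: contra z0 => /eqP E; rewrite -(imod_val z) E; exact: eqxx.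
rewrite /rep; have -> : imod n (c * (x : nat)%:Z - 1) = imod n (z.-1)%:Z.
  rewrite addrC -imodD -/z; congr imod; lia.
have -> : imod n z.-1 = inord z.-1.
  rewrite -(imod_val (inord z.-1)) inordK //; have := ltn_ord z; lia.
by rewrite inordK ?prednK //; have := ltn_ord z; lia.
Qed.

Lemma mul_coprime_neq0 c d (x : 'I_n.+1) : imod n (c * d) = imod n 1 ->
  x != imod n 0 -> imod n (c * (x : nat)%:Z) != imod n 0.
Proof.
move=> /eqP/imodP[k E]; apply: contra => /imodP[l El].
rewrite -(imod_val x); apply/imodP; exists (d * l - k * (x : nat)%:Z).
transitivity (d * (c * (x : nat)%:Z) - k * (x : nat)%:Z * n.+1%:Z).
  have -> : d * (c * (x : nat)%:Z) = (c * d) * (x : nat)%:Z by ring.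
  by rewrite E; ring.
by rewrite El; ring.
Qed.

(** The representative is the same at 0 and [n.+1], while the subtracted [x] grows by [N]. This
    supplies the boundary condition of [det_rank1_sub_step_mx]. *)
Lemma row_carry_period : row_carry n.+1 = row_carry 0 - 1.
Proof. by apply: (@mulIf _ N) => //; rewrite mulrBl !row_carryE repN rep0 mul1r /N; lia. Qed.

(* The two families of exponents are [(a * k - (a + 1) * j) / n.+1] over the pairs [(j, k)] with
   [a * k = (a + 1) * j] modulo [n.+1], with residues taken in [0, n] and in [1, n.+1]
   respectively; they differ only in the pair [(0, 0)], replaced by [(n.+1, n.+1)]. *)
Lemma carry_sum :
  \sum_(x < n.+1) q ^ col_carry x * (q ^ (- row_carry x.+1) - q ^ (- row_carry x)) = 1 - q^-1.
Proof.
pose h (z : 'I_n.+1) : F :=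
  q ^ ((a * (imod n (A * (z : nat)%:Z) : nat)%:Z
        - (a + 1) * (imod n (B * (z : nat)%:Z) : nat)%:Z) %/ N)%Z.
have hE (z : 'I_n.+1) e : e * N = a * (imod n (A * (z : nat)%:Z) : nat)%:Z
        - (a + 1) * (imod n (B * (z : nat)%:Z) : nat)%:Z -> q ^ e = h z.
  by move=> E; rewrite /h -E mulzK.
have E0 : q ^ col_carry 0 * q ^ (- row_carry 0) = q^-1.
  rewrite -expfzDr //; suff -> : col_carry 0 - row_carry 0 = -1 by [].
  by apply: (@mulIf _ N) => //; rewrite mulrBl row_carryE col_carryE !rep0 /N; lia.
have Ex (x : 'I_n.+1) : x != imod n 0 -> q ^ col_carry x * q ^ (- row_carry x) = h x.
  move=> x0; rewrite -expfzDr //; apply: hE.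
  rewrite mulrBl row_carryE col_carryE !rep_neq0; first by ring.
    exact: mul_coprime_neq0 aB x0.
  exact: mul_coprime_neq0 aA x0.
(* For [z = x - a], the representatives [rep A x] and [rep B x.+1] exceed the residues of [A * z]
   and [B * z] by one; the excess [a - (a + 1)] cancels the step from [x] to [x.+1]. *)
have ES (x : 'I_n.+1) : q ^ col_carry x * q ^ (- row_carry x.+1) = h (imod n (- a + (x : nat)%:Z)).
  rewrite -expfzDr //; apply: hE; rewrite mulrBl row_carryE col_carryE !imodM /rep.
  have -> : imod n (A * (- a + (x : nat)%:Z)) = imod n (A * (x : nat)%:Z - 1).
    apply/eqP/imodP; have [k E] := mul_A_eq; exists (- k).
    by rewrite mulrDr mulrN E /N; ring.
  have -> : imod n (B * (- a + (x : nat)%:Z)) = imod n (B * (x.+1)%:Z - 1).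
    apply/eqP/imodP; have [k E] := mul_B_eq; exists (- k).
    rewrite (_ : B * _ = B * (x.+1)%:Z - B * (a + 1)); last by rewrite intS; ring.
    by rewrite E /N; ring.
  by rewrite !intS; ring.
have shift_inj : injective (fun x : 'I_n.+1 => imod n (- a + (x : nat)%:Z)).
  move=> x y /eqP; rewrite eq_imod opprD addrACA subrr add0r -eq_imod !imod_val.
  by move/eqP.
have h0 : h (imod n 0) = 1.
  by rewrite /h !imodM !mulr0 imod0 /= !mulr0 subrr div0z.
under eq_bigr => x _ do rewrite mulrBr ES.
rewrite sumrB -(reindex_inj (P := xpredT) (F := h) shift_inj) /=.
rewrite (bigD1 (imod n 0)) //= [X in _ - X](bigD1 (imod n 0)) //= h0.
have -> : (imod n 0 : nat) = 0%N by rewrite imod0.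
rewrite E0 (eq_bigr _ Ex); ring.
Qed.

Lemma sum_rep c (s : {perm 'I_n.+1}) : (forall x : 'I_n.+1, (s x).+1 = rep c x) ->
  \sum_(x < n.+1) (rep c x)%:Z = \sum_(x < n.+1) (x.+1)%:Z.
Proof.
move=> sE; rewrite [RHS](reindex_inj (@perm_inj _ s)) /=.
by apply: eq_bigr => x _; rewrite sE.
Qed.

(** Both [rep A] and [rep B] run through 1 to [n.+1], so multiplying by [N] leaves [(a + 1) - a = 1]
    times a triangular number. *)
Lemma sum_carries (s t : {perm 'I_n.+1}) : odd n.+1 ->
  (forall x : 'I_n.+1, (s x).+1 = rep B x) -> (forall x : 'I_n.+1, (t x).+1 = rep A x) ->
  \sum_(x < n.+1) (row_carry x - col_carry x) = (n./2).+1%:Z.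
Proof.
move=> on sE tE; apply: (@mulIf _ N) => //; rewrite mulr_suml.
have carryE x : (row_carry x - col_carry x) * N = (a + 1) * (rep B x)%:Z - a * (rep A x)%:Z.
  by rewrite mulrBl row_carryE col_carryE; ring.
under eq_bigr => x _ do rewrite carryE.
rewrite sumrB -!mulr_sumr (sum_rep sE) (sum_rep tE) -mulrBl addrAC subrr add0r mul1r.
have -> m : \sum_(x < m) (x.+1)%:Z = ('C(m.+1, 2))%:Z.
  elim: m => [|m IH]; first by rewrite big_ord0.
  by rewrite big_ord_recr IH [in RHS]binS bin1 PoszD.
rewrite bin2 /N -PoszM; congr Posz; have : ~~ odd n by [].
by move=> /negbTE en; rewrite -{1 3 4}(odd_double_half n) en /=; nia.
Qed.

Lemma det_permuted_qint_ceil (s t : {perm 'I_n.+1}) : odd n.+1 ->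
  (forall x : 'I_n.+1, (s x).+1 = rep B x) -> (forall x : 'I_n.+1, (t x).+1 = rep A x) ->
  \det (\matrix_(x < n.+1, y < n.+1)
     qint q (ceil_frac ((a + 1) * (s x).+1%:Z - a * (t y).+1%:Z) n.+1)) = q ^+ n./2.
Proof.
move=> on sE tE; have q1' : 1 - q != 0 by rewrite subr_eq0 eq_sym.
pose H := \matrix_(x < n.+1, y < n.+1) (q ^ (- row_carry x) * q ^ col_carry y - q ^+ (y < x)%N).
have -> : \matrix_(x < n.+1, y < n.+1)
     qint q (ceil_frac ((a + 1) * (s x).+1%:Z - a * (t y).+1%:Z) n.+1) =
   diag_mx (\row_(x < n.+1) q ^ row_carry x) *m H *m
   diag_mx (\row_(y < n.+1) (q ^ (- col_carry y) / (1 - q))).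
  apply/matrixP=> x y; rewrite mul_mx_diag mul_diag_mx !mxE sE tE.
  (* The fraction is [row_carry x - col_carry y + (x - y) / N] with [x - y] strictly between [- N]
     and [N]. *)
  have -> : ceil_frac ((a + 1) * (rep B x)%:Z - a * (rep A y)%:Z) n.+1 =
            row_carry x - col_carry y + (y < x)%N%:Z.
    apply: ceil_frac_eq => //.
    have := row_carryE x; have := col_carryE y; rewrite -/N => Ecol Erow.
    have -> : (a + 1) * (rep B x)%:Z - a * (rep A y)%:Z =
        (row_carry x - col_carry y) * N + x%:Z - y%:Z.
      by rewrite mulrBl Erow Ecol; ring.
    have := ltn_ord x; have := ltn_ord y; rewrite /N.
    case: ltnP => xy ltx lty; apply/andP; split; nia.
  rewrite /qint !expfzDr // -exprnP mulrA; congr (_ / _).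
  rewrite -!invr_expz; field.
  by rewrite !expfz_neq0.
rewrite !det_mulmx !det_diag.
rewrite (det_rank1_sub_step_mx (A := fun x => q ^ (- row_carry x))
           (fun x => q ^ col_carry x)) //; last first.
  by rewrite row_carry_period opprB expfzDr // expr1z.
rewrite carry_sum -[(-1) ^+ n.+1]signr_odd on.
under eq_bigr => x _ do rewrite mxE.
under [X in _ * X]eq_bigr => x _ do rewrite mxE.
rewrite big_split /= prodr_const card_ord.
have Ecarry : (\prod_(x < n.+1) q ^ row_carry x) * (\prod_(x < n.+1) q ^ (- col_carry x)) =
    q ^+ (n./2).+1.
  rewrite -big_split /= exprnP -(sum_carries on sE tE).
  rewrite (big_morph (fun z : int => q ^ z) (fun m k => expfzDr m k q0) (expr0z q)).
  by apply: eq_bigr => x _; rewrite expfzDr.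
set P1 := \prod_i _ in Ecarry *; set P2 := \prod_i _ in Ecarry *.
(* The minus sign cancels [(-1) ^+ n.+1], the factor [1 - q] completes the power cancelled by the
   column denominators, and [1 / q] lowers the exponent [n./2 + 1] by one. *)
have -> : 1 + (1 - q^-1) / (1 - q) = - (1 - q) / q by field; rewrite q0.
rewrite expr1 exprVn [_ ^+ n.+1]exprS; have Dn0 : (1 - q) ^+ n != 0 by rewrite expf_neq0.
set D := (1 - q) ^+ n in Dn0 *.
transitivity (P1 * P2 / q); first by field; rewrite q0 q1' Dn0.
by rewrite Ecarry exprSr mulfK.
Qed.

End CoprimeCase.

(** * Signs of the permutations and conclusion *)

Lemma det_qint_ceil_coprime (F : fieldType) (q : F) (a : int) n :
  odd n.+1 -> q != 0 -> q != 1 -> coprimez a n.+1 -> coprimez (a + 1) n.+1 ->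
  \det (\matrix_(j < n.+1, k < n.+1)
          qint q (ceil_frac ((a + 1) * (j.+1)%:Z - a * (k.+1)%:Z) n.+1))
  = (jacobi (a * (a + 1)) n.+1)%:~R * q ^+ n./2.
Proof.
move=> on q0 q1 copa copa1.
have inv (c : int) : coprimez c n.+1 ->
    exists d, imod n (d * c) = imod n 1 /\ coprimez d n.+1.
  move=> /coprimezP[[d e] /= E]; exists d; split.
    by apply/eqP/imodP; exists (- e); rewrite -E; ring.
  by apply/coprimezP; exists (c, e); rewrite mulrC.
have [A [aA copA]] := inv _ copa; have [B [aB copB]] := inv _ copa1.
have [sA sAE] := mul_perm_exists copA; have [sB sBE] := mul_perm_exists copB.
(* Index [i] stands for row or column [i + 1], hence the translation by -1. It enters both [s] and
   [t], so its sign cancels. *)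
have tau_inj : injective (fun x : 'I_n.+1 => imod n (-1 + (x : nat)%:Z)).
  move=> x y /eqP; rewrite eq_imod opprD addrACA subrr add0r -eq_imod !imod_val.
  by move/eqP.
pose s := (sB * perm tau_inj)%g; pose t := (sA * perm tau_inj)%g.
have sE (x : 'I_n.+1) : (s x).+1 = (imod n (B * (x : nat)%:Z - 1)).+1.
  by rewrite permM permE sBE imodD addrC.
have tE (x : 'I_n.+1) : (t x).+1 = (imod n (A * (x : nat)%:Z - 1)).+1.
  by rewrite permM permE sAE imodD addrC.
rewrite (det_perm_rows_cols _ s t).
under eq_mx => x y do rewrite mxE.
rewrite (det_permuted_qint_ceil q0 q1 aA aB on sE tE); congr (_ * _).
have copaa : coprimez (a * (a + 1)) n.+1 by rewrite coprimezMl copa.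
have [r rE] := mul_perm_exists copaa.
rewrite -(zolotarev on copaa rE) rmorph_sign; congr (_ ^+ nat_of_bool _).
(* Multiplication by [a * (a + 1)] undoes the two inverse multiplications, so its parity is the sum
   of theirs. *)
have : (sB * sA * r)%g = 1%g.
  apply/permP=> x; rewrite perm1 !permM sBE sAE imodM rE imodM.
  rewrite -[RHS]imod_val; apply/eqP/imodP.
  have /eqP/imodP[k Ek] := aA; have /eqP/imodP[l El] := aB.
  exists ((k + l + k * l * n.+1%:Z) * (x : nat)%:Z).
  rewrite (_ : a * (a + 1) * (A * (B * (x : nat)%:Z)) = (A * a) * (B * (a + 1)) * (x : nat)%:Z);
    last by ring.
  by rewrite Ek El; ring.
move/(congr1 (@odd_perm _)); rewrite odd_perm1 !odd_permM.
by case: (odd_perm sA); case: (odd_perm sB); case: (odd_perm r); case: (odd_perm _).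
Qed.

Theorem theorem1p2 (F : fieldType) (q : F) (a : int) (n : nat) :
  (0 < n)%N -> odd n -> q != 0 -> q != 1 ->
  \det (\matrix_(j < n, k < n)
          qint q (ceil_frac ((a + 1) * (j.+1)%:Z - a * (k.+1)%:Z) n))
  = (jacobi (a * (a + 1)) n)%:~R * q ^+ (n.-1)./2.
Proof.
move=> n0 on q0 q1.
have common_prime (c : int) : ~~ coprimez c n ->
    exists p, [/\ prime p, odd p, (p %| n)%N & (p %| c)%Z].
  rewrite coprimezE /= => ncop; have g1 : (1 < gcdn `|c| n)%N.
    by rewrite ltn_neqAle eq_sym ncop gcdn_gt0 n0 orbT.
  have pn : (pdiv (gcdn `|c| n) %| n)%N := dvdn_trans (pdiv_dvd _) (dvdn_gcdr _ _).
  exists (pdiv (gcdn `|c| n)); split=> //; first exact: pdiv_prime.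
    exact: dvdn_odd pn on.
  by rewrite dvdzE; apply: dvdn_trans (pdiv_dvd _) (dvdn_gcdl _ _).
have [copa|/common_prime[p [pr op pn pa]]] := boolP (coprimez a n); last first.
  (* Transposition turns the columns into rows, with [- a] as the multiplier. *)
  rewrite (jacobi_eq0 n0 pr pn) ?dvdz_mulr // mul0r -det_tr.
  have pNa : (p %| - a)%Z by rewrite rpredN.
  rewrite -(det_qint_ceil_eq0 (fun j => (a + 1) * (j.+1)%:Z) n0 q0 pr op pn pNa).
  by congr (\det _); apply/matrixP=> j k; rewrite !mxE mulNr addrC.
have [copa1|/common_prime[p [pr op pn pa]]] := boolP (coprimez (a + 1) n); last first.
  rewrite (jacobi_eq0 n0 pr pn) ?dvdz_mull // mul0r.
  exact: (det_qint_ceil_eq0 (fun k => - (a * (k.+1)%:Z)) n0 q0 pr op pn).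
by case: n n0 on copa copa1 {common_prime} => // n _ on copa copa1; apply: det_qint_ceil_coprime.
Qed.
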